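(* Let $\pi = \{I_1,\ldots,I_m\}$ be a partition of $\{1,\ldots,N\}$, where $N\ge 1$. (1) For $A\in\mathbb{C}^{N\times N}$, the matrix $\Sigma^\downarrow_\pi(A)$ is invertible if and only if $\Theta^\downarrow_\pi(A)$ is, in which case \[ \Theta^\downarrow_\pi(A)^{-1} = D_\pi^{-1/2}\,\Sigma^\downarrow_\pi(A)^{-1} D_\pi^{-1/2}. \] (2) If $A \in \overline{\mathcal{S}_\pi}$, then the Moore--Penrose pseudo-inverse of $A$ is \[ A^\dagger = \Theta^\uparrow_\pi\bigl(\Theta^\downarrow_\pi(A)^\dagger\bigr). \]
   Context: $\overline{\mathcal{S}_\pi}$ is the closure of the set $\mathcal{S}_\pi$ of matrices $A\in\mathbb{C}^{N\times N}$ for which $\pi$ is the coarsest partition such that $A$ is constant on each block $I_i\times I_j$; equivalently, $\overline{\mathcal{S}_\pi}$ is the set of all $A\in\mathbb{C}^{N\times N}$ constant on each block $I_i\times I_j$. The matrix $\mathcal{W}_\pi \in \mathbb{C}^{N\times m}$ has $(i,j)$ entry $1$ if $i\in I_j$ and $0$ otherwise, and $D_\pi := \operatorname{diag}(|I_1|,\ldots,|I_m|)$. The compression $\Sigma^\downarrow_\pi:\mathbb{C}^{N\times N}\to\mathbb{C}^{m\times m}$ is $\Sigma^\downarrow_\pi(A)_{ij} := \frac{1}{|I_i|\,|I_j|}\sum_{p\in I_i,\,q\in I_j} a_{pq}$. The weighted compression and inflation are $\Theta^\downarrow_\pi(A) := D_\pi^{1/2}\Sigma^\downarrow_\pi(A)D_\pi^{1/2}$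 for $A \in \mathbb{C}^{N\times N}$ and $\Theta^\uparrow_\pi(B) := \mathcal{W}_\pi D_\pi^{-1/2}BD_\pi^{-1/2}\mathcal{W}_\pi^*$ for $B\in\mathbb{C}^{m\times m}$. $A^\dagger$ denotes the Moore--Penrose pseudo-inverse of $A$. *)

(* Defs.v *)
From HB Require Import structures.
From mathcomp Require Import all_boot all_order all_algebra.
From mathcomp Require Import all_classical reals topology normedtype.
From mathcomp Require Export complex.

Set Implicit Arguments.
Unset Strict Implicit.
Unset Printing Implicit Defensive.

Import Order.TTheory GRing.Theory Num.Theory.
Import numFieldNormedType.Exports.

Local Open Scope ring_scope.
Local Open Scope sesquilinear_scope.

(* All definitions are over an arbitrary [numClosedFieldType]; the field of
   complex numbers is the instance [R[i]] with [R : realType].  Matrices over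
   such a field carry the product topology of the topology given by the norm,
   that is, the Euclidean topology when the field is [R[i]]. *)

Section MoorePenrose.
Context {C : numClosedFieldType}.

Definition penrose m n (A : 'M[C]_(m, n)) (X : 'M[C]_(n, m)) : bool :=
  [&& A *m X *m A == A,
      X *m A *m X == X,
      (A *m X)^t* == A *m X
    & (X *m A)^t* == X *m A].

Lemma penrose_uniq m n (A : 'M[C]_(m, n)) (X Y : 'M[C]_(n, m)) :
  penrose A X -> penrose A Y -> X = Y.
Proof.
move=> /and4P[/eqP x1 /eqP x2 /eqP x3 /eqP x4].
move=> /and4P[/eqP y1 /eqP y2 /eqP y3 /eqP y4].
have AE : A *m X = A *m Y.
  rewrite -[LHS]x3 -{1}y1 -[A *m Y *m A *m X]mulmxA trmx_mul map_mxM /=.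
  by rewrite x3 y3 mulmxA x1.
have EA : X *m A = Y *m A.
  rewrite -[LHS]x4 -{1}y1 -[A *m Y *m A]mulmxA mulmxA trmx_mul map_mxM /=.
  by rewrite x4 y4 -mulmxA (mulmxA A) x1.
by rewrite -x2 -mulmxA AE mulmxA EA y2.
Qed.

Lemma gram_unit r n (B : 'M[C]_(r, n)) : row_free B -> B *m B^t* \in unitmx.
Proof.
move=> freeB; rewrite -row_free_unit -kermx_eq0; apply/eqP/row_matrixP => i.
rewrite row0; set u := row i _.
have u0 : u *m (B *m B^t*) = 0 by apply/sub_kermxP; exact: row_sub.
have : (u *m B) *m (u *m B)^t* = 0.
  by rewrite trmx_mul map_mxM /= mulmxA -(mulmxA u) u0 mul0mx.
move/matrixP/(_ 0 0); rewrite !mxE => /eqP; rewrite psumr_eq0; last first.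
  by move=> j _; rewrite !mxE mul_conjC_ge0.
move=> /allP s0; apply: (row_free_inj freeB).
rewrite mul0mx; apply/rowP => j; apply/eqP.
have := s0 j (mem_index_enum j); rewrite !mxE /=.
by rewrite mul_conjC_eq0.
Qed.

Lemma penrose_exists m n (A : 'M[C]_(m, n)) : exists X, penrose A X.
Proof.
have [r [F [G [fF fG <-]]]] : exists r (F : 'M[C]_(m, r)) (G : 'M[C]_(r, n)),
    [/\ row_full F, row_free G & F *m G = A].
  exists (\rank A), (col_base A), (row_base A).
  by rewrite col_base_full row_base_free mulmx_base.
have uG : G *m G^t* \in unitmx by exact: gram_unit.
have uF : F^t* *m F \in unitmx.
  have := @gram_unit _ _ (F^t*); rewrite trmxCK; apply.
  by rewrite /row_free mxrank_map mxrank_tr.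
pose K := invmx (F^t* *m F); pose H := invmx (G *m G^t*).
have KF : K *m F^t* *m F = 1%:M by rewrite -mulmxA mulVmx.
have GH : G *m (G^t* *m H) = 1%:M by rewrite mulmxA mulmxV.
have adj_inv k (M : 'M[C]_k) : M^t* = M -> (invmx M)^t* = invmx M.
  by move=> MM; rewrite trmx_inv map_invmx /= MM.
have Kt : K^t* = K by apply: adj_inv; rewrite trmx_mul map_mxM /= trmxCK.
have Ht : H^t* = H by apply: adj_inv; rewrite trmx_mul map_mxM /= trmxCK.
pose X := G^t* *m H *m (K *m F^t*).
have AX : F *m G *m X = F *m (K *m F^t*).
  by rewrite /X mulmxA -(mulmxA F) GH mulmx1.
have XA : X *m (F *m G) = G^t* *m H *m G.
  by rewrite /X mulmxA -(mulmxA (G^t* *m H)) KF mulmx1.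
exists X; apply/and4P; split; apply/eqP.
- by rewrite AX mulmxA -(mulmxA F) KF mulmx1.
- by rewrite XA /X mulmxA -(mulmxA (G^t* *m H) G) GH mulmx1.
- by rewrite AX !trmx_mul !map_mxM /= Kt trmxCK mulmxA.
- by rewrite XA !trmx_mul !map_mxM /= Ht trmxCK mulmxA.
Qed.

(* The Moore-Penrose pseudo-inverse, unique by [penrose_uniq]. *)
Definition mpinv m n (A : 'M[C]_(m, n)) : 'M[C]_(n, m) :=
  xchoose (penrose_exists A).

Lemma mpinvP m n (A : 'M[C]_(m, n)) : penrose A (mpinv A).
Proof. exact: xchooseP. Qed.

End MoorePenrose.

Definition blocks N m (I : 'I_m -> {set 'I_N}) : {set {set 'I_N}} :=
  I @: 'I_m.

(* [I] enumerates, without repetition, the blocks of a partition of ['I_N];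
   [finset.partition] requires the blocks to be nonempty. *)
Definition partition_enum N m (I : 'I_m -> {set 'I_N}) : bool :=
  injectiveb I && finset.partition (blocks I) [set: 'I_N]%SET.

Section Compression.
Context {C : numClosedFieldType} (N m : nat) (I : 'I_m -> {set 'I_N}).

Definition block_constant (P : {set {set 'I_N}}) (A : 'M[C]_N) : Prop :=
  forall B B', B \in P -> B' \in P ->
  forall p p' q q', p \in B -> p' \in B -> q \in B' -> q' \in B' ->
  A p q = A p' q'.

Definition refines (P Q : {set {set 'I_N}}) : Prop :=
  forall B, B \in P -> exists2 B', B' \in Q & B \subset B'.

(* "Coarsest" means greatest for refinement. *)
Definition stratum : set 'M[C]_N :=
  [set A | block_constant (blocks I) A /\
    forall P, finset.partition P [set: 'I_N]%SET -> block_constant P A ->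
      refines P (blocks I)].

Definition stratum_closure : set 'M[C]_N := closure stratum.

Definition Wmx : 'M[C]_(N, m) := \matrix_(i, j) (i \in I j)%:R.

(* The powers 1/2 and -1/2 of the diagonal matrix of block sizes. *)
Definition Dmx_sqrt : 'M[C]_m := diag_mx (\row_j sqrtC #|I j|%:R).

Definition Dmx_isqrt : 'M[C]_m := diag_mx (\row_j (sqrtC #|I j|%:R)^-1).

Definition Sigma_down (A : 'M[C]_N) : 'M[C]_m :=
  \matrix_(i, j) ((#|I i|%:R * #|I j|%:R)^-1 *
                  \sum_(p in I i) \sum_(q in I j) A p q).

Definition Theta_down (A : 'M[C]_N) : 'M[C]_m :=
  Dmx_sqrt *m Sigma_down A *m Dmx_sqrt.

Definition Theta_up (B : 'M[C]_m) : 'M[C]_N :=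
  Wmx *m Dmx_isqrt *m B *m Dmx_isqrt *m Wmx^t*.

End Compression.

(* Main.v *)
Require Import Defs.
From mathcomp Require Import all_boot all_algebra reals.
From mathcomp Require Import order classical_sets topology normedtype.

(** The columns of [Wmx I] are the indicator vectors of the blocks.  They are
    orthogonal, with squared norms the block sizes, so [V := W D^(-1/2)] is an
    isometry: [V^* V = 1] ([block_isometryP]).

    The first part is that [Theta_down] multiplies [Sigma_down] on both sides
    by the invertible matrix [D^(1/2)].

    For the second part, [Theta_up B = V B V^*], and a matrix constant on the
    blocks satisfies [A = V (Theta_down A) V^*] ([Theta_downK]).  Conjugation
    by an isometry preserves the four Penrose equations
    ([penrose_isometry]), since every inner product [V^* V] cancels; hence
    [V (Theta_down A)^+ V^*] is the pseudo-inverse of [A] by uniqueness.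
    Finally, constancy on the blocks is a family of equalities between
    entries, so it passes from the stratum to its closure
    ([stratum_closure_block_constant]). *)

Set Implicit Arguments.
Unset Strict Implicit.
Unset Printing Implicit Defensive.

Import Order.TTheory GRing.Theory Num.Theory.
Import numFieldNormedType.Exports.

Local Open Scope ring_scope.
Local Open Scope sesquilinear_scope.

Lemma penrose_isometry (C : numClosedFieldType) m n (V : 'M[C]_(n, m))
    (B X : 'M[C]_m) :
  V^t* *m V = 1%:M -> penrose B X ->
  penrose (V *m B *m V^t*) (V *m X *m V^t*).
Proof.
move=> VV /and4P[/eqP e1 /eqP e2 /eqP e3 /eqP e4].
have mulV (P Q : 'M[C]_m) :
    (V *m P *m V^t*) *m (V *m Q *m V^t*) = V *m (P *m Q) *m V^t*.
  by rewrite -!mulmxA (mulmxA (V^t*) V) VV mul1mx.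
have adjV (P : 'M[C]_m) : (V *m P *m V^t*)^t* = V *m P^t* *m V^t*.
  by rewrite !trmx_mul !map_mxM /= trmxCK mulmxA.
by apply/and4P; split; apply/eqP; rewrite !mulV ?adjV ?e1 ?e2 ?e3 ?e4.
Qed.

Lemma mpinv_isometry (C : numClosedFieldType) m n (V : 'M[C]_(n, m))
    (B : 'M[C]_m) :
  V^t* *m V = 1%:M -> mpinv (V *m B *m V^t*) = V *m mpinv B *m V^t*.
Proof.
move=> VV; apply: penrose_uniq (mpinvP _) _.
by apply: penrose_isometry (mpinvP B).
Qed.

(** Two entries that differ in the limit by [d] still differ for all matrices
    entrywise within [`|d| / 2] of it. *)
Lemma stratum_closure_block_constant (C : numClosedFieldType) N m
    (I : 'I_m -> {set 'I_N}) (A : 'M[C]_N) :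
  stratum_closure I A -> block_constant (blocks I) A.
Proof.
move=> clA B B' PB PB' p p' q q' pB p'B qB' q'B'.
apply/eqP/negPn/negP => neq.
pose e := `|A p q - A p' q'| / 2.
have e0 : 0 < e by rewrite divr_gt0 ?normr_gt0 ?subr_eq0.
have [X [[cX _] [_ AX]]] := clA _ (nbhsx_ballx A e e0).
have h1 := AX p q; have h2 := AX p' q'.
rewrite -(cX _ _ PB PB' p p' q q') // in h2.
have := ball_splitl h1 h2.
by rewrite /ball /= ltxx.
Qed.

Section Blocks.
Context (C : numClosedFieldType) (N m : nat) (I : 'I_m -> {set 'I_N}).
Hypothesis partI : partition_enum I.

Let block_mem j : I j \in blocks I.
Proof. exact: finset.imset_f. Qed.

Lemma block_card_neq0 j : #|I j|%:R != 0 :> C.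
Proof.
case/andP: partI => _ /and3P[_ _ I0].
rewrite pnatr_eq0 cards_eq0; apply: contraNneq I0 => <-.
exact: block_mem.
Qed.

Lemma block_uniq i j p : p \in I i -> p \in I j -> i = j.
Proof.
case/andP: partI => /injectiveP injI /and3P[_ tI _] pi pj; apply: injI.
by rewrite -(finset.def_pblock tI (block_mem i) pi) (finset.def_pblock tI (block_mem j) pj).
Qed.

Lemma block_exists p : exists j, p \in I j.
Proof.
case/andP: partI => _ /and3P[/eqP cI _ _].
have /bigcupP[_ /imsetP[j _ ->] pj] : p \in finset.cover (blocks I).
  by rewrite cI inE.
by exists j.
Qed.

Lemma Dmx_sqrtK : Dmx_sqrt (C := C) I *m Dmx_isqrt I = 1%:M.
Proof.
apply/matrixP => i j; rewrite mul_diag_mx !mxE.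
case: eqVneq => [_|_]; last by rewrite !mulr0n mulr0.
by rewrite !mulr1n divff // sqrtC_eq0 block_card_neq0.
Qed.

Lemma Dmx_isqrtK : Dmx_isqrt (C := C) I *m Dmx_sqrt I = 1%:M.
Proof. exact: mulmx1C Dmx_sqrtK. Qed.

Lemma Dmx_isqrt_adj : (Dmx_isqrt (C := C) I)^t* = Dmx_isqrt I.
Proof.
rewrite tr_diag_mx map_diag_mx; congr diag_mx; apply/rowP => j; rewrite !mxE.
by rewrite /= conj_Creal // realV ger0_real // sqrtC_ge0 ler0n.
Qed.

Lemma Wmx_gram :
  (Wmx (C := C) I)^t* *m Wmx I = Dmx_sqrt I *m Dmx_sqrt I.
Proof.
apply/matrixP => i j; rewrite mul_diag_mx !mxE.
have -> : \sum_k (Wmx (C := C) I)^t* i k * Wmx I k j =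
    \sum_k (if k \in I i then (k \in I j)%:R else 0).
  apply: eq_bigr => k _; rewrite !mxE conjC_nat.
  by case: (k \in I i); rewrite ?mul1r ?mul0r.
rewrite -big_mkcond /=; case: (eqVneq i j) => [<-|neq].
  rewrite mulr1n -expr2 sqrtCK -sum1_card natr_sum.
  by apply: eq_bigr => k ->.
rewrite mulr0n mulr0 big1 // => k ki; case: (boolP (k \in I j)) => // kj.
by rewrite (block_uniq ki kj) eqxx in neq.
Qed.

Definition block_isometry : 'M[C]_(N, m) := Wmx I *m Dmx_isqrt I.

Lemma block_isometryP : block_isometry^t* *m block_isometry = 1%:M.
Proof.
rewrite trmx_mul map_mxM /= Dmx_isqrt_adj /block_isometry.
rewrite -mulmxA (mulmxA _ (Wmx I)) Wmx_gram !mulmxA Dmx_isqrtK mul1mx.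
exact: Dmx_sqrtK.
Qed.

Lemma Theta_upE B : Theta_up I B = block_isometry *m B *m block_isometry^t*.
Proof. by rewrite trmx_mul map_mxM /= Dmx_isqrt_adj mulmxA. Qed.

Lemma Sigma_down_block_constant (A : 'M[C]_N) i j p q :
  block_constant (blocks I) A -> p \in I i -> q \in I j ->
  Sigma_down I A i j = A p q.
Proof.
move=> cA pi qj; rewrite mxE.
under eq_bigr => p' p'i.
  under eq_bigr => q' q'j
    do rewrite (cA _ _ (block_mem i) (block_mem j) p' p q' q) //.
  rewrite sumr_const -mulr_natl; over.
rewrite sumr_const -[X in _ * X]mulr_natl mulrA mulKf //.
by rewrite mulf_neq0 ?block_card_neq0.
Qed.

(** The diagonal factors cancel and leave [W (Sigma_down A) W^*].  Row [p] of
    [W] is the unit vector at the block of [p], so the entry at [(p, q)] is the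
    average of [A] over the block pair containing [(p, q)], that is [A p q]. *)
Lemma Theta_downK (A : 'M[C]_N) :
  block_constant (blocks I) A -> Theta_up I (Theta_down I A) = A.
Proof.
move=> cA; rewrite /Theta_up /Theta_down !mulmxA.
rewrite -(mulmxA (Wmx I)) Dmx_isqrtK mulmx1.
rewrite -(mulmxA _ (Dmx_sqrt I)) Dmx_sqrtK mulmx1.
have WE (i : 'I_m) (p : 'I_N) (k : 'I_m) : p \in I i ->
    Wmx (C := C) I p k = (k == i)%:R.
  move=> pi; rewrite mxE; congr (nat_of_bool _)%:R.
  by apply/idP/eqP => [pk|-> //]; apply: block_uniq pk pi.
apply/matrixP => p q.
have [i pi] := block_exists p; have [j qj] := block_exists q.
rewrite -(Sigma_down_block_constant cA pi qj) mxE (bigD1 j) //= big1; last first.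
  move=> k /negPf kj; rewrite [_^t* _ _]mxE [_^T _ _]mxE.
  by rewrite (WE _ _ _ qj) kj conjC0 mulr0.
rewrite addr0 [_^t* _ _]mxE [_^T _ _]mxE (WE _ _ _ qj) eqxx conjC1 mulr1.
rewrite mxE (bigD1 i) //= big1 => [|k /negPf ki]; last first.
  by rewrite (WE _ _ _ pi) ki mul0r.
by rewrite addr0 (WE _ _ _ pi) eqxx mul1r.
Qed.

Lemma Theta_down_unit (A : 'M[C]_N) :
  (Theta_down I A \in unitmx) = (Sigma_down I A \in unitmx).
Proof.
have [uS _] := mulmx1_unit Dmx_sqrtK.
by rewrite /Theta_down !unitmx_mul uS andbT.
Qed.

Lemma invmx_Theta_down (A : 'M[C]_N) : Sigma_down I A \in unitmx ->
  invmx (Theta_down I A) =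
    Dmx_isqrt I *m invmx (Sigma_down I A) *m Dmx_isqrt I.
Proof.
move=> uS; have uT : Theta_down I A \in unitmx by rewrite Theta_down_unit.
apply: (can_inj (mulKmx uT)); rewrite mulmxV // /Theta_down.
rewrite !mulmxA -(mulmxA _ (Dmx_sqrt I)) Dmx_sqrtK mulmx1.
by rewrite mulmxK // Dmx_sqrtK.
Qed.

End Blocks.

Local Open Scope complex_scope.

Theorem mainTheorem8 (R : realType) (N m : nat) (I : 'I_m -> {set 'I_N}) :
  (0 < N)%N -> partition_enum I ->
  (forall A : 'M[R[i]]_N,
     (Sigma_down I A \in unitmx <-> Theta_down I A \in unitmx) /\
     (Sigma_down I A \in unitmx ->
        invmx (Theta_down I A) =
          Dmx_isqrt I *m invmx (Sigma_down I A) *m Dmx_isqrt I)) /\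
  (forall A : 'M[R[i]]_N,
     stratum_closure I A ->
     mpinv A = Theta_up I (mpinv (Theta_down I A))).
Proof.
move=> _ partI; split=> A.
  by split; [rewrite Theta_down_unit | exact: invmx_Theta_down].
move/stratum_closure_block_constant => cA.
rewrite -[in LHS](Theta_downK partI cA) !Theta_upE.
exact: mpinv_isometry (block_isometryP _ partI).
Qed.
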